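(* Let $A\in\mathbb{R}^{n\times n}$ be a $P$-matrix such that $A=D-L-U$, where $D=dI$ with $d>0$, and $L$, $U$ are strictly lower and strictly upper triangular matrices, respectively. Let $q\in\mathbb{R}^n$. For fixed $\alpha>0$ and $\beta\in\mathbb{R}$, consider the splitting $A=M-N$ with $$M=\frac1\alpha(D-\beta L),\qquad N=\frac1\alpha\left\{(1-\alpha)D+(\alpha-\beta)L+\alpha U\right\}.$$ Let $\gamma>0$ and let $\Omega_4$ be chosen such that $\gamma\Omega_4=D$. Let $\Omega_1=\phi_1 I$ and $\Omega_2=\phi_2 L$, where $\phi_1,\phi_2\in\mathbb{R}$. Suppose that the pair $(|L|,|U|)$ satisfies the spectral-scaling property $$\rho(a|L|+b|U|)=\sqrt{ab}\,\rho(|L|+|U|)\qquad\text{for all } a,b>0.$$ Let $\kappa_m:=\rho(|L|+|U|)>0$ and assume that $d>\kappa_m$. Then the relaxed shifted matrix-splitting modulus-based iteration method (with these $M,N,\Omega_1,\Omega_2,\Omega_4,\gamma$) converges to the unique solution of $\operatorname{LCP}(q,A)$ for every initial vector $x^{(0)}\in\mathbb{R}^n$ if either of the following conditions holds: 1. $$\kappa_m-\frac d\alpha<\phi_1<d\left(1-\frac1\alpha\right)$$ and $$1-\frac{(d/\alpha+\phi_1)^2}{\kappa_m^2}-\frac\beta\alpha<\phi_2<\frac{(d/\alpha+\phi_1)^2}{\kappa_m^2}-\frac\beta\alpha;$$ 2. $$\phi_1\ge d\left(1-\frac1\alpha\right)$$ and $$1-\frac{d^2}{\kappa_m^2}-\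frac\beta\alpha<\phi_2<\frac{d^2}{\kappa_m^2}-\frac\beta\alpha.$$
   Context: For $A\in\mathbb{R}^{n\times n}$ and $q\in\mathbb{R}^n$, $\operatorname{LCP}(q,A)$ is the problem of finding $z,w\in\mathbb{R}^n$ with $w=Az+q$, $z\ge 0$, $w\ge 0$, $z^Tw=0$ (inequalities componentwise); $z$ is referred to as the solution. A $P$-matrix is a real square matrix all of whose principal minors are positive. $|X|$ denotes the entrywise absolute value of a matrix or vector $X$, and $\rho(X)$ is the spectral radius. The subscript in $\kappa_m$ is only notation. Relaxed shifted matrix-splitting modulus-based iteration method: given a splitting $A=M-N$, matrices $\Omega_1,\Omega_2\in\mathbb{R}^{n\times n}$, $\gamma>0$, a positive diagonal matrix $\Omega_4$ and $x^{(0)}\in\mathbb{R}^n$, compute for $k=0,1,2,\ldots$ $$(M+\Omega_1-\Omega_2+\gamma\Omega_4)x^{(k+1)}=(N+\Omega_1-\Omega_2)x^{(k)}+(\gamma\Omega_4-A)|x^{(k)}|-\gamma q,$$ $$z^{(k+1)}=\frac1\gamma\left(|x^{(k+1)}|+x^{(k+1)}\right).$$ The method ''converges to the unique solution of $\operatorname{LCP}(q,A)$'' means that the coefficient matrix $M+\Omega_1-\Omega_2+\gamma\Omega_4$ is nonsingular (so the iteration is well defined), the sequence $x^{(k)}$ converges, and $z^{(k)}$ converges to the unique solution $z^\ast$ of $\operatorname{LCP}(q,A)$. *)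

(* Defs.v *)
From mathcomp Require Import all_boot all_order all_algebra.
From mathcomp Require Import all_classical all_reals all_analysis.
From mathcomp Require Import complex.

Set Implicit Arguments.
Unset Strict Implicit.
Unset Printing Implicit Defensive.

Import Order.TTheory GRing.Theory Num.Theory.
Import numFieldNormedType.Exports.

Local Open Scope classical_set_scope.
Local Open Scope ring_scope.

(* Entrywise absolute value; the library's `|X| on matrices is a norm. *)
Definition mxabs (R : numDomainType) (m n : nat) (X : 'M[R]_(m, n)) :
  'M[R]_(m, n) := map_mx Num.norm X.

(* The eigenvalues of a real matrix are taken over R[i].  They are finitely many,
   so for n > 0 the supremum is a maximum; for n = 0 it is sup set0 = 0. *)
Definition spectral_radius (R : realType) (n : nat) (X : 'M[R]_n) : R :=
  sup [set Normc.normc l | l in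
    [set l : R[i] | eigenvalue (map_mx (real_complex R) X) l]].

Definition spectral_scaling (R : realType) (n : nat) (X Y : 'M[R]_n) : Prop :=
  forall a b : R, 0 < a -> 0 < b ->
    spectral_radius (a *: X + b *: Y) =
    Num.sqrt (a * b) * spectral_radius (X + Y).

Definition principal_submx (R : Type) (n : nat) (A : 'M[R]_n)
    (S : {set 'I_n}) : 'M[R]_#|S| :=
  mxsub (@enum_val _ (mem S)) (@enum_val _ (mem S)) A.

(* The empty minor equals 1, so S = set0 imposes nothing. *)
Definition P_matrix (R : numDomainType) (n : nat) (A : 'M[R]_n) : Prop :=
  forall S : {set 'I_n}, 0 < \det (principal_submx A S).

Definition strictly_lower (R : nmodType) (n : nat) (X : 'M[R]_n) : Prop :=
  forall i j : 'I_n, (i <= j)%N -> X i j = 0.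

Definition strictly_upper (R : nmodType) (n : nat) (X : 'M[R]_n) : Prop :=
  forall i j : 'I_n, (j <= i)%N -> X i j = 0.

Definition positive_diagonal (R : numDomainType) (n : nat) (X : 'M[R]_n) :
  Prop := is_diag_mx X /\ forall i : 'I_n, 0 < X i i.

Definition lcp_solution (R : numDomainType) (n : nat) (q : 'cV[R]_n)
    (A : 'M[R]_n) (z : 'cV[R]_n) : Prop :=
  exists w : 'cV[R]_n,
    [/\ w = A *m z + q,
        forall i, 0 <= z i 0,
        forall i, 0 <= w i 0
      & z^T *m w = 0].

Section Method.
Variables (R : realType) (n : nat).
Variables (A M N Omega1 Omega2 Omega4 : 'M[R]_n) (gamma : R) (q : 'cV[R]_n).

Definition msm_coefmx : 'M[R]_n := M + Omega1 - Omega2 + gamma *: Omega4.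

Definition msm_iterates (x0 : 'cV[R]_n) (x : nat -> 'cV[R]_n) : Prop :=
  x 0%N = x0 /\
  forall k : nat,
    msm_coefmx *m x k.+1 =
    (N + Omega1 - Omega2) *m x k
    + (gamma *: Omega4 - A) *m mxabs (x k) - gamma *: q.

Definition msm_z (x : 'cV[R]_n) : 'cV[R]_n := gamma^-1 *: (mxabs x + x).

(* When msm_coefmx is invertible, exactly one sequence x satisfies
   msm_iterates x0 x, so quantifying over x is not vacuous. *)
Definition msm_converges (x0 : 'cV[R]_n) : Prop :=
  msm_coefmx \in unitmx /\
  exists zs : 'cV[R]_n,
    unique (lcp_solution q A) zs /\
    forall x : nat -> 'cV[R]_n, msm_iterates x0 x ->
      cvgn x /\ (fun k => msm_z (x k.+1)) @ \oo --> zs.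

End Method.

(* Main.v *)
(* Write c = d/alpha + phi1 and s = beta/alpha + phi2.  The iteration reads
     ((c+d) I - s L) x' = ((c-d) I + (1-s) L + U) x + (L + U)|x| - gamma q,
   so the difference e of two trajectories satisfies, entrywise,
     (c+d)|e'| <= |s||L||e'| + (|c-d| I + (1+|1-s|)|L| + 2|U|)|e|.
   By spectral scaling, the assumptions on phi1 and phi2 say exactly that
   B = (1+|s|+|1-s|)|L| + 2|U| has spectral radius less than
   c+d-|c-d| = 2 min(c,d).  Then some v > 0 satisfies Bv < (c+d-|c-d|)v, and
   the iteration contracts the norm max_i |x_i|/v_i.  Its fixed point exists by
   Banach's theorem, and fixed points correspond to LCP solutions through
   gamma z = |x| + x, gamma w = d(|x| - x), so the LCP solution exists and is
   unique. *)

Require Import Defs.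
From HB Require Import structures.
From mathcomp Require Import all_boot all_order all_algebra.
From mathcomp Require Import all_classical all_reals all_analysis.
From mathcomp Require Import complex ring lra.

Import Order.TTheory GRing.Theory Num.Theory.
Import numFieldNormedType.Exports.

Local Open Scope ring_scope.

(** * Spectral radius and positive subinvariant vectors *)

(** The supremum dominates its set once the set has an upper bound: the characteristic polynomial
    splits over [R[i]], and the sum of the moduli of its roots is such a bound. *)
Lemma eigenvalue_le_spectral_radius {R : realType} {n : nat} (X : 'M[R]_n)
    (l : R[i]) :
  eigenvalue (map_mx (real_complex R) X) l ->
  Normc.normc l <= spectral_radius X.
Proof.
move=> ev_l; apply: ub_le_sup; last by exists l.
have [rs Ers] :=
  closed_field_poly_normal (char_poly (map_mx (real_complex R) X)).
have normc_ge0 (z : R[i]) : 0 <= Normc.normc z.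
  by case: z => a b; exact: sqrtr_ge0.
exists (\sum_(r <- rs) Normc.normc r) => _ [k ev_k <-].
move: ev_k => /=; rewrite eigenvalue_root_char Ers (monicP (char_poly_monic _)).
rewrite scale1r root_prod_XsubC => rs_k.
by rewrite (big_rem k rs_k)/= lerDl sumr_ge0.
Qed.

Lemma root_char_poly_le_spectral_radius {R : realType} {n : nat} (X : 'M[R]_n)
    (t : R) :
  root (char_poly X) t -> t <= spectral_radius X.
Proof.
move=> Xt; apply: le_trans (ler_norm t) _.
have -> : `|t| = Normc.normc (real_complex R t).
  by rewrite /= expr0n /= addr0 sqrtr_sqr.
apply: eigenvalue_le_spectral_radius.
by rewrite eigenvalue_root_char -map_char_poly fmorph_root.
Qed.

(** Row [i] of [(XI - B) adj(XI - B) 1 = p 1], with [p] the characteristic polynomial: a resolvent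
    equation free of division. *)
Lemma char_poly_mx_adj_row_sum {R : comNzRingType} {n : nat} (B : 'M[R]_n)
    (i : 'I_n) (h := \adj (char_poly_mx B) *m const_mx 1 : 'cV_n) :
  'X * h i 0 - \sum_j (B i j)%:P * h j 0 = char_poly B.
Proof.
have : (char_poly_mx B *m h) i 0 = char_poly B.
  by rewrite mulmxA mul_mx_adj mul_scalar_mx !mxE mulr1.
rewrite mulmxBl mul_scalar_mx !mxE => <-; congr (_ - _).
by apply: eq_bigr => j _; rewrite !mxE.
Qed.

(* Evaluated at t, the polynomials are p(t)^2 (tI - B)^-1 1 with p the
   characteristic polynomial: positive for large t, and they cannot lose
   positivity while moving t down to m. *)
Lemma exists_pos_subinvariant {R : realType} {n : nat} (B : 'M[R]_n) (m : R) :
  (forall i j, 0 <= B i j) -> 0 < m -> spectral_radius B < m ->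
  exists v : 'cV[R]_n,
    (forall i, 0 < v i 0) /\ forall i, (B *m v) i 0 < m * v i 0.
Proof.
move=> B0 m0 Bm.
pose p := char_poly B.
pose g i := p * (\adj (char_poly_mx B) *m const_mx 1 : 'cV_n) i 0.
have gE t i : t * (g i).[t] = \sum_j B i j * (g j).[t] + p.[t] ^+ 2.
  have := congr1 (fun r => (p * r).[t]) (char_poly_mx_adj_row_sum B i).
  rewrite -/p mulrBr mulrCA -/(g i) mulr_sumr hornerD hornerN hornerM hornerX.
  rewrite hornerM -expr2 => /eqP; rewrite subr_eq addrC => /eqP ->.
  rewrite horner_exp; congr (_ + _).
  by rewrite horner_sum; apply: eq_bigr => j _;
    rewrite mulrCA -/(g j) hornerM hornerC.
have p2_gt0 t : m <= t -> 0 < p.[t] ^+ 2.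
  move=> mt; rewrite exprn_even_gt0 //=; apply/negP => pt.
  by have := root_char_poly_le_spectral_radius _ _ pt;
    rewrite leNgt (lt_le_trans Bm mt).
pose E := [set t | m <= t /\ exists i, (g i).[t] <= 0]%classic.
have E0 : E = set0.
  apply/eqP; apply: contraT => /set0P neE.
  (* For [t] beyond the sum of all entries of [B], a nonpositive minimal [g i] would give
     [t g_i <= \sum_j B_ij g_j], against [gE] with its positive term [p.[t] ^+ 2]. *)
  have E_ub : ubound E (\sum_i \sum_j B i j).
    move=> t [mt [i0 gi0]]; rewrite leNgt; apply/negP => Kt.
    case: (@arg_minP _ _ _ i0 xpredT (fun i => (g i).[t]) isT) => i _ imin.
    have gi : (g i).[t] <= 0 by exact: le_trans (imin i0 isT) gi0.
    have := gE t i; apply/eqP; rewrite lt_eqF// -[ltLHS]addr0.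
    apply: ler_ltD; last exact: p2_gt0.
    apply: (@le_trans _ _ (\sum_j B i j * (g i).[t])); last first.
      by apply: ler_sum => j _; apply: ler_wpM2l => //; exact: imin.
    rewrite -mulr_suml; apply: ler_wnM2r => //; apply: le_trans (ltW Kt).
    rewrite [leRHS](bigD1 i)//= lerDl; apply: sumr_ge0 => k _; exact: sumr_ge0.
  have supE : has_sup E by split=> //; exists (\sum_i \sum_j B i j).
  set t0 := sup E.
  have mt0 : m <= t0.
    have [t Et] := neE; apply: le_trans Et.1 _; exact: (sup_upper_bound supE).
  have g_right t i : t0 < t -> 0 < (g i).[t].
    move=> t0t; rewrite ltNge; apply/negP => gt.
    have Et : E t by split; [exact: le_trans mt0 (ltW t0t) | exists i].
    by have := sup_upper_bound supE Et; rewrite leNgt t0t.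
  have g_ge0 i : 0 <= (g i).[t0].
    rewrite leNgt; apply/negP => gi.
    have : \forall t \near t0, (g i).[t] < 0.
      by apply: (cvgr_lt _ (@continuous_horner R (g i) t0)).
    move=> /nbhs_ballP[e /= e0 He].
    have : ball t0 e (t0 + e / 2).
      rewrite /ball /= opprD addrA subrr add0r normrN gtr0_norm ?divr_gt0 //.
      by rewrite ltr_pdivrMr // ltr_pMr // ltr1n.
    move=> /He; apply/negP; rewrite -leNgt ltW // g_right // ltrDl.
    by rewrite divr_gt0.
  (* [gE] upgrades nonnegativity at the supremum to positivity; by continuity this holds in a
     neighbourhood of [t0], which must meet [E]. *)
  have g_gt0 i : 0 < (g i).[t0].
    rewrite -(pmulr_rgt0 _ (lt_le_trans m0 mt0)) gE ltr_wpDl ?p2_gt0 //.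
    by apply: sumr_ge0 => j _; exact: mulr_ge0.
  have : \forall t \near t0, forall i, 0 < (g i).[t].
    apply: (filter_forall (F := nbhs t0)) => i.
    exact: (cvgr_gt _ (@continuous_horner R (g i) t0)).
  move=> /nbhs_ballP[e /= e0 He].
  have [t Et tlt] := sup_adherent e0 supE; have [mt [i gi]] := Et.
  have : ball t0 e t.
    have tt0 : t <= t0 by exact: (sup_upper_bound supE).
    by rewrite /ball /= ger0_norm ?subr_ge0 // ltrBlDr -ltrBlDl.
  by move=> /He /(_ i); rewrite ltNge gi.
(* By [gE], this vector satisfies [B v = m v - p(m)^2 1]. *)
exists (\col_i (g i).[m]); split=> i.
  rewrite mxE ltNge; apply/negP => gi.
  have : E m by split=> //; exists i.
  by rewrite E0.
rewrite !mxE gE -[ltLHS]addr0 ler_ltD ?p2_gt0 //.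
by apply: ler_sum => j _; rewrite mxE.
Qed.

(** * Contractions in a weighted maximum norm *)

(** Banach's theorem asks for completeness and the norm in a single structure. *)
HB.instance Definition _ (R : realType) m n := Complete.on 'M[R]_(m, n).

Lemma cvg_mx_entrywise {R : realType} {m n : nat} (x : nat -> 'M[R]_(m, n))
    (l : 'M[R]_(m, n)) :
  (forall i j, (fun k => x k i j) @ \oo --> l i j)%classic ->
  (x @ \oo --> l)%classic.
Proof.
move=> xl; apply/cvg_ballP => e e0.
have : \forall k \near \oo%classic, forall i j, ball (l i j) e (x k i j).
  by apply: filter_forall => i; apply: filter_forall => j;
    move/cvg_ballP: (xl i j); exact.
by apply: filterS => k xk; split.
Qed.

Lemma mx_norm_leP {R : realType} {m n : nat} (x : 'M[R]_(m, n)) (t : R) :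
  0 <= t -> `|x| <= t <-> forall i j, `|x i j| <= t.
Proof.
move=> t0; rewrite [X in X <= t](mx_normrE x); split => [xt i j|xt].
  by have /bigmax_leP[_ /(_ (i, j) isT)] := xt.
by apply/bigmax_leP; split=> // ij _; exact: xt.
Qed.

(** Rescaling the coordinates by [v] (maps [V] and [W]) turns the weighted bound into a contraction
    of the maximum norm, to which Banach's theorem applies. *)
Lemma weighted_contraction_cvg {R : realType} {n : nat} (v : 'cV[R]_n)
    (theta : R) (F : 'cV[R]_n -> 'cV[R]_n) :
  (forall i, 0 < v i 0) -> 0 <= theta -> theta < 1 ->
  (forall (x y : 'cV[R]_n) t, (forall i, `|x i 0 - y i 0| <= t * v i 0) ->
     forall i, `|F x i 0 - F y i 0| <= theta * t * v i 0) ->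
  exists xs, [/\ F xs = xs, (forall y, F y = y -> y = xs) &
    forall x : nat -> 'cV[R]_n, (forall k, x k.+1 = F (x k)) ->
      forall i, ((fun k => x k i 0) @ \oo --> xs i 0)%classic].
Proof.
move=> v0 theta0 theta1 Fv.
pose V (y : 'cV[R]_n) := \col_i (v i 0 * y i 0).
pose W (y : 'cV[R]_n) := \col_i (y i 0 / v i 0).
have vN0 i : v i 0 != 0 by rewrite gt_eqF.
have WK : cancel W V by move=> y; apply/colP => i; rewrite !mxE mulrC divfK.
pose G y := W (F (V y)).
have G_fun : set_fun [set: 'cV[R]_n]%classic [set: 'cV[R]_n]%classic G by [].
pose g := mkfun G_fun.
have gctr : contraction (NngNum theta0) g.
  split=> // -[x y] _ /=.
  apply/mx_norm_leP => [|i j]; first by rewrite mulr_ge0.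
  rewrite ord1 !mxE -mulrBl normrM normfV (gtr0_norm (v0 i)) ler_pdivrMr //.
  apply: Fv => {}i; rewrite !mxE -mulrBr normrM gtr0_norm // mulrC ler_pM2r //.
  have /mx_norm_leP := lexx `|x - y|.
  by move=> /(_ (normr_ge0 _)) /(_ i 0); rewrite !mxE.
have gctr' : is_contraction g by exists (NngNum theta0).
have [|//|ys _ ysE] := @banach_fixed_point _ _ _ g gctr'.
- exact: closedT.
- by exists 0.
exists (V ys); split=> [|y Fy|x xF i].
- by rewrite -[LHS]WK; congr V; rewrite [RHS]ysE.
- rewrite -[LHS]WK; congr V.
  by apply: (contraction_fixpoint_unique gctr') => //;
    rewrite -[RHS]/(W (F (V (W y)))) WK Fy.
have xE k : x k = V (iter k g (W (x 0%N))).
  elim: k => [|k IH] /=; first by rewrite WK.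
  by rewrite xF {1}IH -[RHS]/(V (W (F (V (iter k g (W (x 0%N))))))) WK.
(* The limit of the Picard iterates is a fixed point, hence equals [ys] by uniqueness. *)
have iterE : (iter k g (W (x 0%N)) @[k --> \oo] --> ys)%classic.
  rewrite -(_ : lim (iter k g (W (x 0%N)) @[k --> \oo])%classic = ys).
    exact: (contraction_cvg gctr).
  apply: (contraction_fixpoint_unique gctr') => //.
  by apply: (contraction_cvg_fixed gctr) => //; exact: closedT.
under eq_fun do rewrite xE mxE.
rewrite mxE; apply: cvgMl_tmp.
apply: (cvg_comp _ (fun M : 'cV[R]_n => M i 0) iterE); exact: coord_continuous.
Qed.

(* Bounding |e'| by its value at the index maximising |e' i| / v i makes the
   implicit term P |e'| harmless. *)
Lemma implicit_weighted_contraction {R : realFieldType} {n : nat}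
    (P Q : 'M[R]_n) (v : 'cV[R]_n) (c : R) :
  (forall i j, 0 <= P i j) -> (forall i j, 0 <= Q i j) ->
  (forall i, 0 < v i 0) ->
  (forall i, (P *m v) i 0 + (Q *m v) i 0 < c * v i 0) ->
  exists theta, [/\ 0 <= theta, theta < 1 &
    forall (e e' : 'cV[R]_n) t,
      (forall i, c * `|e' i 0| <=
        (P *m mxabs e') i 0 + (Q *m mxabs e) i 0) ->
      (forall i, `|e i 0| <= t * v i 0) ->
      forall i, `|e' i 0| <= theta * t * v i 0].
Proof.
move=> P0 Q0 v0 PQv.
pose X i := (Q *m v) i 0; pose Y i := c * v i 0 - (P *m v) i 0.
have X0 i : 0 <= X i.
  by rewrite /X mxE sumr_ge0 // => j _; rewrite mulr_ge0 // ltW.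
have XY i : X i < Y i by rewrite /Y ltrBrDl PQv.
have Y0 i : 0 < Y i by exact: le_lt_trans (X0 i) (XY i).
(* The default value 0 keeps [theta] nonnegative, also when [n = 0]. *)
pose theta := \big[Order.max/0]_i (X i / Y i).
have theta_ge i : X i <= theta * Y i.
  by rewrite -ler_pdivrMr // /theta; exact: le_bigmax.
exists theta; split=> [||e e' t ee' et i0].
- exact: bigmax_ge_id.
- by apply: bigmax_lt => // i _; rewrite ltr_pdivrMr // mul1r.
have t0 : 0 <= t.
  by rewrite -(pmulr_lge0 _ (v0 i0)) (le_trans _ (et i0)).
pose i := [arg max_(i > i0) (`|e' i 0| / v i 0)]%O; pose s := `|e' i 0| / v i 0.
have e's j : `|e' j 0| <= s * v j 0.
  rewrite -ler_pdivrMr // /s /i.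
  by case: Order.TotalTheory.arg_maxP => // k _; exact.
(* At the maximising index, [c s v_i <= s (P v)_i + t (Q v)_i]; moving the [P] term to the left
   leaves [s * Y i]. *)
have s_le : s * Y i <= t * X i.
  have Ee' : `|e' i 0| = s * v i 0 by rewrite divfK // gt_eqF.
  have := ee' i; rewrite Ee' => /le_trans-/(_ (s * (P *m v) i 0 + t * X i)) H.
  rewrite mulrBr mulrCA lerBlDl; apply: H; apply: lerD.
    rewrite !mxE mulr_sumr; apply: ler_sum => j _.
    by rewrite mxE mulrCA ler_wpM2l.
  rewrite /X !mxE mulr_sumr; apply: ler_sum => j _.
  by rewrite mxE mulrCA ler_wpM2l.
apply: le_trans (e's i0) _; rewrite ler_pM2r // -(ler_pM2r (Y0 i)).
by apply: le_trans s_le _; rewrite (mulrC theta) -mulrA ler_wpM2l.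
Qed.

(** * Complementarity problem and modulus equation *)

(** This is [gamma w = gamma (A z + q)] after substituting [gamma z = |x| + x] and
    [gamma w = d (|x| - x)]. *)
Definition modulus_equation {R : realType} {n : nat} (A : 'M[R]_n)
    (q : 'cV[R]_n) (d gamma : R) (x : 'cV[R]_n) : Prop :=
  A *m x + d *: x = d *: mxabs x - A *m mxabs x - gamma *: q.

Lemma trmulmx_eq0 {R : realDomainType} {n : nat} (z w : 'cV[R]_n) :
  (forall i, 0 <= z i 0) -> (forall i, 0 <= w i 0) ->
  z^T *m w = 0 <-> forall i, z i 0 * w i 0 = 0.
Proof.
move=> z0 w0; split=> [zw i|zw].
  have := congr1 (fun M : 'M[R]_1 => M 0 0) zw; rewrite /= !mxE => /eqP.
  rewrite psumr_eq0 => [/allP/(_ i (mem_index_enum _))|j _].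
    by rewrite mxE => /eqP.
  by rewrite mxE mulr_ge0.
by apply/matrixP => i j; rewrite !ord1 !mxE big1 // => k _; rewrite mxE.
Qed.

(** Complementarity holds since [z_i w_i] is a multiple of [|x_i|^2 - x_i^2 = 0]. *)
Lemma lcp_solution_of_modulus {R : realType} {n : nat} (A : 'M[R]_n)
    (q : 'cV[R]_n) (d gamma : R) (x : 'cV[R]_n) :
  0 < d -> 0 < gamma -> modulus_equation A q d gamma x ->
  lcp_solution q A (msm_z gamma x).
Proof.
move=> d_gt0 gamma_gt0 xE; exists ((d / gamma) *: (mxabs x - x)).
have z0 i : 0 <= msm_z gamma x i 0.
  rewrite !mxE mulr_ge0 // ?invr_ge0 ?(ltW gamma_gt0) //.
  by rewrite -lerBlDr sub0r -normrN ler_norm.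
have w0 i : 0 <= ((d / gamma) *: (mxabs x - x)) i 0.
  rewrite !mxE mulr_ge0 // ?divr_ge0 ?(ltW d_gt0) ?(ltW gamma_gt0) //.
  by rewrite subr_ge0 ler_norm.
split=> //.
- rewrite /msm_z -scalemxAr mulmxDr.
  have -> : A *m mxabs x + A *m x = d *: (mxabs x - x) - gamma *: q.
    rewrite scalerBr [LHS]addrC; apply/eqP; rewrite -subr_eq0; apply/eqP.
    have := congr1 (fun u => u - (d *: mxabs x - A *m mxabs x - gamma *: q)) xE.
    rewrite /= subrr => <-; apply/colP => i; rewrite !mxE; ring.
  by apply/colP => i; rewrite !mxE; field; rewrite gt_eqF.
apply/trmulmx_eq0 => // i; rewrite !mxE.
have := real_normK (num_real (x i 0)) => xx.
by rewrite mulrACA [X in _ * X]mulrC -subr_sqr xx subrr mulr0.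
Qed.

(** Solving the substitution for [x] gives the witness; as [z_i] or [w_i] vanishes at each index,
    [|x|] is the same expression with a plus sign. *)
Lemma modulus_of_lcp_solution {R : realType} {n : nat} (A : 'M[R]_n)
    (q : 'cV[R]_n) (d gamma : R) (z : 'cV[R]_n) :
  0 < d -> 0 < gamma -> lcp_solution q A z ->
  exists2 x, modulus_equation A q d gamma x & msm_z gamma x = z.
Proof.
move=> d_gt0 gamma_gt0 [w [wE z0 w0 /(trmulmx_eq0 _ _ z0 w0) zw]].
pose x := (gamma / 2) *: (z - d^-1 *: w).
have absx : mxabs x = (gamma / 2) *: (z + d^-1 *: w).
  apply/colP => i; rewrite !mxE normrM gtr0_norm ?divr_gt0 //; congr (_ * _).
  have := zw i => /eqP; rewrite mulf_eq0 => /orP[] /eqP ->.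
    by rewrite sub0r add0r normrN ger0_norm // mulr_ge0 // invr_ge0 ltW.
  by rewrite mulr0 subr0 addr0 ger0_norm.
have dN0 : d != 0 by rewrite gt_eqF.
have gN0 : gamma != 0 by rewrite gt_eqF.
exists x.
  rewrite /modulus_equation.
  have -> : d *: mxabs x = d *: x + gamma *: w.
    by rewrite absx; apply/colP => i; rewrite !mxE; field.
  have -> : mxabs x = gamma *: z - x.
    by rewrite absx; apply/colP => i; rewrite !mxE; field.
  have Az : A *m z = w - q by rewrite wE addrK.
  rewrite mulmxBr; move: (A *m x) => Ax; rewrite -scalemxAr Az.
  by apply/colP => i; rewrite !mxE; ring.
by rewrite /msm_z absx; apply/colP => i; rewrite !mxE; field; rewrite gN0 dN0.
Qed.

(** * Scalar and entrywise estimates for the iteration *)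

Lemma norm_mulmx_le {R : numDomainType} {m n : nat} (X : 'M[R]_(m, n))
    (e f : 'cV[R]_n) :
  (forall j, `|e j 0| <= f j 0) ->
  forall i, `|(X *m e) i 0| <= (mxabs X *m f) i 0.
Proof.
move=> ef i; rewrite !mxE; apply: le_trans (ler_norm_sum _ _ _) _.
by apply: ler_sum => j _; rewrite normrM !mxE ler_wpM2l.
Qed.

(** The factor [|s| + 1 + |1 - s|] is [2 max(1, s, 1 - s)] and the right side is [2 min(c, d)]. With
    [mu = min(c, d)], squaring leaves three bounds by [mu ^+ 2], one for each term of the
    maximum. *)
Lemma sqrt_scaling_lt (R : rcfType) (kappa c d s : R) :
  0 < kappa -> kappa < d ->
  (kappa < c < d /\ 1 - c ^+ 2 / kappa ^+ 2 < s < c ^+ 2 / kappa ^+ 2) \/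
  (d <= c /\ 1 - d ^+ 2 / kappa ^+ 2 < s < d ^+ 2 / kappa ^+ 2) ->
  Num.sqrt ((`|s| + 1 + `|1 - s|) * 2) * kappa < c + d - `|c - d|.
Proof.
move=> k0 kd hcond; have k20 : 0 < kappa ^+ 2 by rewrite exprn_gt0.
have [mu [kmu smu smu' ->]] : exists mu, [/\ kappa < mu,
    s * kappa ^+ 2 < mu ^+ 2, (1 - s) * kappa ^+ 2 < mu ^+ 2 &
    c + d - `|c - d| = 2 * mu].
  case: hcond => [[/andP[kc cd]]|[dc]] /andP[h1 h2]; [exists c | exists d];
    rewrite -!ltr_pdivlMr //; split=> //.
  - by lra.
  - by rewrite ler0_norm ?subr_le0 ?ltW //; ring.
  - by lra.
  - by rewrite ger0_norm ?subr_ge0 //; ring.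
have mu0 : 0 < mu by exact: lt_trans kmu.
have km2 : kappa ^+ 2 < mu ^+ 2 by rewrite ltr_pXn2r // nnegrE ltW.
have x0 : 0 < 2 * mu / kappa by rewrite divr_gt0 ?mulr_gt0.
rewrite -ltr_pdivlMr // -[ltRHS](ger0_norm (ltW x0)) -[ltRHS]sqrtr_sqr.
rewrite ltr_sqrt ?exprn_gt0 //.
rewrite expr_div_n ltr_pdivlMr // exprMn.
by case: (ler0P s); case: (ler0P (1 - s)) => *; lra.
Qed.

(** Here [b] plays the role of [|x| - |y|] for [e = x - y]. Bounding it by [|e|] adds one more [|L|]
    and one more [|U|] to the weights of [|e|]. *)
Lemma residual_norm_le {R : realDomainType} {n : nat} (L U : 'M[R]_n)
    (c d s : R) (e e' b : 'cV[R]_n) :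
  0 <= c + d ->
  ((c + d)%:M - s *: L) *m e' =
    ((c - d)%:M + (1 - s) *: L + U) *m e + (L + U) *m b ->
  (forall j, `|b j 0| <= `|e j 0|) ->
  forall i, (c + d) * `|e' i 0| <=
    ((`|s| *: mxabs L) *m mxabs e') i 0 +
    ((`|c - d|%:M + ((1 + `|1 - s|) *: mxabs L + 2 *: mxabs U)) *m mxabs e) i 0.
Proof.
move=> cd0 ee'b be i.
have le_mxabs (f g : 'cV[R]_n) (X : 'M[R]_n) :
    (forall j, `|f j 0| <= `|g j 0|) ->
    `|(X *m f) i 0| <= (mxabs X *m mxabs g) i 0.
  by move=> fg; apply: norm_mulmx_le => j; rewrite !mxE.
have := le_mxabs e' e' L (fun=> lexx _).
have := le_mxabs e e L (fun=> lexx _); have := le_mxabs e e U (fun=> lexx _).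
have := le_mxabs b e L be; have := le_mxabs b e U be.
move: ee'b; rewrite mulmxBl !mulmxDl !mul_scalar_mx -!scalemxAl.
move: (L *m e') (L *m e) (U *m e) (L *m b) (U *m b) => Le' Le Ue Lb Ub.
move: (mxabs L *m mxabs e') (mxabs L *m mxabs e) (mxabs U *m mxabs e) => X' X Y.
move=> /(congr1 (fun u : 'cV[R]_n => u i 0)); rewrite !mxE.
move=> E HUb HLb HUe HLe HLe'.
rewrite -[X in X * `|_|](ger0_norm cd0) -normrM.
have -> : (c + d) * e' i 0 =
  s * Le' i 0 +
  ((c - d) * e i 0 + (1 - s) * Le i 0 + Ue i 0 + (Lb i 0 + Ub i 0)).
  by rewrite -E; ring.
apply: le_trans (ler_normD _ _) _; apply: lerD.
  by rewrite normrM ler_wpM2l.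
apply: le_trans (ler_normD _ _) _.
have := ler_normD ((c - d) * e i 0 + (1 - s) * Le i 0) (Ue i 0).
have := ler_normD ((c - d) * e i 0) ((1 - s) * Le i 0).
have := ler_normD (Lb i 0) (Ub i 0).
rewrite !normrM; have := ler_wpM2l (normr_ge0 (1 - s)) HLe.
lra.
Qed.

(** * Convergence of the relaxed shifted iteration *)

Theorem theorem4p3 (R : realType) (n : nat)
  (A D L U M N Omega1 Omega2 Omega4 : 'M[R]_n) (q : 'cV[R]_n)
  (d alpha beta gamma phi1 phi2 kappam : R)
  (hP : P_matrix A)
  (hA : A = D - L - U)
  (hD : D = d%:M) (hd : 0 < d)
  (hL : strictly_lower L) (hU : strictly_upper U)
  (halpha : 0 < alpha)
  (hM : M = alpha^-1 *: (D - beta *: L))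
  (hN : N = alpha^-1 *:
          ((1 - alpha) *: D + (alpha - beta) *: L + alpha *: U))
  (hgamma : 0 < gamma)
  (hOmega4 : positive_diagonal Omega4) (hOmega4D : gamma *: Omega4 = D)
  (hOmega1 : Omega1 = phi1%:M)
  (hOmega2 : Omega2 = phi2 *: L)
  (hscal : spectral_scaling (mxabs L) (mxabs U))
  (hkappa : kappam = spectral_radius (mxabs L + mxabs U))
  (hkappa_gt0 : 0 < kappam) (hdkappa : kappam < d)
  (hcond :
    (kappam - d / alpha < phi1 < d * (1 - alpha^-1) /\
     1 - (d / alpha + phi1) ^+ 2 / kappam ^+ 2 - beta / alpha < phi2
       < (d / alpha + phi1) ^+ 2 / kappam ^+ 2 - beta / alpha)
    \/
    (d * (1 - alpha^-1) <= phi1 /\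
     1 - d ^+ 2 / kappam ^+ 2 - beta / alpha < phi2
       < d ^+ 2 / kappam ^+ 2 - beta / alpha)) :
  forall x0 : 'cV[R]_n,
    msm_converges A M N Omega1 Omega2 Omega4 gamma q x0.
Proof.
move=> x0.
have aN0 : alpha != 0 by rewrite gt_eqF.
pose c := d / alpha + phi1; pose s := beta / alpha + phi2.
have cond :
    (kappam < c < d /\
     1 - c ^+ 2 / kappam ^+ 2 < s < c ^+ 2 / kappam ^+ 2) \/
    (d <= c /\ 1 - d ^+ 2 / kappam ^+ 2 < s < d ^+ 2 / kappam ^+ 2).
  rewrite /s; case: hcond => -[h1 h2]; [left|right]; rewrite -/c in h2;
    (split; last by lra); rewrite /c; lra.
have cd_gt0 : 0 < c + d.
  by case: cond => -[h _]; lra.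
have rho_lt := sqrt_scaling_lt _ _ _ _ _ hkappa_gt0 hdkappa cond.
set a : R := `|s| + 1 + `|1 - s| in rho_lt.
set m : R := c + d - `|c - d| in rho_lt.
have a0 : 0 < a by rewrite /a ltr_wpDr // ltr_wpDl.
have m0 : 0 < m.
  by apply: le_lt_trans rho_lt; rewrite mulr_ge0 ?sqrtr_ge0 // ltW.
pose B : 'M[R]_n := a *: mxabs L + 2 *: mxabs U.
have [|//||v [v0 Bv]] := exists_pos_subinvariant B m.
- by move=> i j; rewrite !mxE addr_ge0 // mulr_ge0 // ltW.
(* Scaling with weights [a] and 2 gives [B] the spectral radius [sqrt(2a) kappam], which [rho_lt]
   puts below [m]. *)
- by rewrite /B hscal // -hkappa.
pose P : 'M[R]_n := `|s| *: mxabs L.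
pose Q : 'M[R]_n := `|c - d|%:M + ((1 + `|1 - s|) *: mxabs L + 2 *: mxabs U).
(* Since [m = c + d - |c - d|], this identity reduces the condition on [P] and [Q] to
   [B v < m v]. *)
have Q_def : P + Q = `|c - d|%:M + B.
  rewrite /P /Q /B /a; apply/matrixP => i j; rewrite !mxE.
  by move: (_ *+ _) => z; ring.
have [||//||theta [theta0 theta1 contr]] :=
    implicit_weighted_contraction P Q v (c + d).
- by move=> i j; rewrite !mxE mulr_ge0.
- by move=> i j; rewrite !mxE !addr_ge0 ?mulr_ge0 ?mulrn_wge0 // addr_ge0.
- move=> i.
  have addE (x y : 'cV[R]_n) : x i 0 + y i 0 = (x + y) i 0 by rewrite mxE.
  rewrite addE -mulmxDl Q_def mulmxDl -addE mul_scalar_mx.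
  by rewrite [X in X + _ < _]mxE -ltrBrDl -mulrBl.
set T := msm_coefmx M Omega1 Omega2 Omega4 gamma.
have TE : T = (c + d)%:M - s *: L.
  rewrite /T /msm_coefmx hOmega4D hM hD hOmega1 hOmega2 /c /s.
  apply/matrixP => i j; rewrite !mxE.
  by case: (i == j); rewrite ?mulr1n ?mulr0n; field.
pose S : 'M[R]_n := N + Omega1 - Omega2.
pose K : 'M[R]_n := gamma *: Omega4 - A.
have SE : S = (c - d)%:M + (1 - s) *: L + U.
  rewrite /S hN hD hOmega1 hOmega2 /c /s.
  apply/matrixP => i j; rewrite !mxE.
  by case: (i == j); rewrite ?mulr1n ?mulr0n; field.
have KE : K = L + U.
  by rewrite /K hOmega4D hA; apply/matrixP => i j; rewrite !mxE; ring.
(* [T] is lower triangular with constant diagonal [c + d > 0]. *)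
have Tunit : T \in unitmx.
  have Ttrig : is_trig_mx T.
    apply/is_trig_mxP => i j ij; rewrite TE !mxE hL ?(ltnW ij) //.
    by rewrite (_ : (i == j) = false) ?mulr0 ?subr0 // -val_eqE ltn_eqF.
  rewrite unitmxE det_trig // unitfE; apply/prodf_neq0 => i _.
  by rewrite TE !mxE eqxx hL // mulr0 subr0 gt_eqF.
pose F (x : 'cV[R]_n) : 'cV[R]_n :=
  invmx T *m (S *m x + K *m mxabs x - gamma *: q).
have TF (x y : 'cV[R]_n) :
    F x = y <-> T *m y = S *m x + K *m mxabs x - gamma *: q.
  by split=> [<-|Ty]; [rewrite mulKVmx | rewrite /F -Ty mulKmx].
have [//|//|//||xs [Fxs xs_unique xs_cvg]] :=
    weighted_contraction_cvg v theta F.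
  move=> x y t xyt i.
  pose e' := F x - F y; pose e := x - y.
  have -> : F x i 0 - F y i 0 = e' i 0 by rewrite !mxE.
  apply: (contr e) => [{}i|{}i]; last by rewrite !mxE.
  apply: (residual_norm_le L U c d s e e' (mxabs x - mxabs y)) => [||j].
  - exact: ltW.
  - rewrite -TE -SE -KE !mulmxBr (TF x _).1 // (TF y _).1 //.
    move: (S *m x) (S *m y) (K *m mxabs x) (K *m mxabs y) => Sx Sy Kx Ky.
    by apply/colP => k; rewrite !mxE; ring.
  - by rewrite !mxE ler_dist_dist.
(* A fixed point of [F] thus solves [(A + D) x = (D - A)|x| - gamma q], the modulus equation. *)
have A_S : T - S = A + D.
  rewrite TE SE hA hD; apply/matrixP => i j; rewrite !mxE.
  by case: (i == j); rewrite ?mulr1n ?mulr0n; ring.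
have K_DA : K = D - A by rewrite /K hOmega4D.
have F_modulus x : F x = x <-> modulus_equation A q d gamma x.
  rewrite TF /modulus_equation -!mul_scalar_mx -hD.
  have -> : A *m x + D *m x = T *m x - S *m x by rewrite -mulmxDl -A_S mulmxBl.
  have -> : D *m mxabs x - A *m mxabs x = K *m mxabs x by rewrite K_DA mulmxBl.
  rewrite -addrA; split=> [->|/eqP]; first by rewrite [LHS]addrC addKr.
  by rewrite subr_eq addrC => /eqP.
split=> //; exists (msm_z gamma xs); split.
  split; first by apply: (lcp_solution_of_modulus _ _ d) => //; apply/F_modulus.
  (* Every LCP solution comes from a fixed point of [F], so uniqueness carries over. *)
  move=> z /(modulus_of_lcp_solution _ _ d gamma _ hd hgamma).
  case=> x /F_modulus Fx <-.
  by rewrite (xs_unique x Fx).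
move=> x [_ xE].
have x_cvg i : ((fun k => x k i 0) @ \oo --> xs i 0)%classic.
  by apply: xs_cvg => k; symmetry; apply/TF; rewrite xE.
split.
  by apply/cvg_ex; exists xs; apply: cvg_mx_entrywise => i j; rewrite ord1.
apply: cvg_mx_entrywise => i j; rewrite ord1 !mxE.
under eq_fun do rewrite !mxE.
(* The vectors [z] are formed from [x k.+1], so the limit is needed for the shifted sequence. *)
have xS_cvg : ((fun k => x k.+1 i 0) @ \oo --> xs i 0)%classic.
  by move: (x_cvg i); rewrite -(cvg_shiftS (fun k => x k i 0)).
apply: cvgMl_tmp; apply: cvgD => //; exact: cvg_norm.
Qed.
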